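(* Assume P1: there is $\delta_0>0$ such that $\int_{\mathbb G} N(g)^{\delta_0}\,\boldsymbol\mu(\mathrm dg)<+\infty$. Let $\mathscr B$ be the Banach space built from $\delta_0$ in the context. Then $\mathscr B$ contains a sequence of nonnegative functions $\tilde N,\tilde N_1,\tilde N_2,\dots$ such that: 1. There exist $p_{\max}>2$, $\gamma>0$ and $c>0$ such that for every $x\in\mathbb X$ and every $n\ge1$, $$\max\Big\{|\rho(x)|^{1+\gamma},\ \|\boldsymbol\delta_x\|_{\mathscr B'},\ \mathbb E_x^{1/p_{\max}}\big(\tilde N(X_n)^{p_{\max}}\big)\Big\}\le c\,(1+\tilde N(x)),$$ and $\tilde N(x)\mathbf 1_{\{\tilde N(x)>l\}}\le\tilde N_l(x)$ for every $x\in\mathbb X$ and every integer $l\ge1$. 2. There exists $c>0$ such that $\|\tilde N_l\|_{\mathscr B}\le c$ for every integer $l\ge1$. 3. There exist $\delta>0$ and $c>0$ such that for every integer $l\ge1$, $$\big|\tilde{\boldsymbol\nu}(\tilde N_l)\big|\le\frac{c}{l^{1+\delta}}.$$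
   Context: Let $d\ge 1$ and $\mathbb G=\mathrm{GL}_d(\mathbb R)$. $\mathbb R^d$ carries the Euclidean norm $\|\cdot\|$ and $\mathbb G$ the associated operator norm $\|g\|$. $\mathbb P(\mathbb R^d)$ is the projective space; $\overline v$ is the direction of $v\in\mathbb R^d\setminus\{0\}$; $d(\overline u,\overline v)=\|u\wedge v\|/(\|u\|\|v\|)$, where $\|u\wedge v\|^2=\|u\|^2\|v\|^2-\langle u,v\rangle^2$; $g\cdot\overline v=\overline{gv}$. Put $N(g)=\max(\|g\|,\|g^{-1}\|)$. $(g_n)_{n\ge1}$ are i.i.d. $\mathbb G$-valued random variables with law $\boldsymbol\mu$, $G_n=g_n\cdots g_1$, $G_0=\mathrm{Id}$. Let $\mathbb X=\mathbb G\times\mathbb P(\mathbb R^d)$ and $\rho(g,\overline v)=\log(\|gv\|/\|v\|)$. For $x=(g,\overline v)\in\mathbb X$, $X_0=x$ and $X_n=(g_n,G_{n-1}g\cdot\overline v)$, $n\ge1$, is a Markov chain; $\mathbb E_x$ is expectation when $X_0=x$, and $\mathbb E_x^{1/p}(\cdot)=(\mathbb E_x(\cdot))^{1/p}$. $\boldsymbol\nu$ is a $\boldsymbol\mu$-invariant probability measure on $\mathbb P(\mathbb R^d)$, i.e. $\int\int\varphi(g\cdot\overline u)\,\boldsymbol\mu(\mathrm dg)\boldsymbol\nu(\mathrm d\overline u)=\int\varphi\,\mathrm d\boldsymbol\nu$ for continuous $\varphi$, and $\tilde{\boldsymbol\nu}(h)=\int_{\mathbb X}h(g_1,\overline v)\,\boldsymbol\nu(\mathrm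 d\overline v)\boldsymbol\mu(\mathrm dg_1)$ for $h\in\mathscr B$. With $\delta_0>0$ the constant of P1, put $\varepsilon=\delta_0/8$, $\theta=3\varepsilon$, $\alpha=5\varepsilon$, $\beta=7\varepsilon$. For continuous $h:\mathbb X\to\mathbb C$ let $$|h|_\theta=\sup_{(g,\overline u)\in\mathbb X}\frac{|h(g,\overline u)|}{N(g)^\theta},\quad k_{\varepsilon,\alpha}(h)=\sup_{g\in\mathbb G,\ \overline u\ne\overline v}\frac{|h(g,\overline u)-h(g,\overline v)|}{d(\overline u,\overline v)^\varepsilon N(g)^\alpha},\quad k'_{\varepsilon,\beta}(h)=\sup_{g\neq g',\ \overline u}\frac{|h(g,\overline u)-h(g',\overline u)|}{\|g-g'\|^\varepsilon N(g)^\beta N(g')^\beta},$$ $\|h\|_{\mathscr B}=|h|_\theta+k_{\varepsilon,\alpha}(h)+k'_{\varepsilon,\beta}(h)$, and $\mathscr B=\{h\text{ continuous}:\|h\|_{\mathscr B}<+\infty\}$, a Banach space with norm $\|\cdot\|_{\mathscr B}$. $\mathscr B'$ is its dual and $\boldsymbol\delta_x:h\mapsto h(x)$ the Dirac measure at $x$.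
   Formalization: The formal theorem assumes $\delta_0\le 8$ (so $\varepsilon\le1$); for $\delta_0>8$ finiteness of $k'_{\varepsilon,\beta}$ forces $\tilde N$ to be constant along $t\,\mathrm{Id}$, while $|\rho|^{1+\gamma}$ is unbounded there, so item 1 always fails. *)

(* Defs.v *)
From HB Require Import structures.
From mathcomp Require Import all_boot all_order all_algebra.
From mathcomp Require Import generic_quotient.
From mathcomp Require Export complex.
From mathcomp Require Import all_classical all_reals all_analysis.

Set Implicit Arguments.
Unset Strict Implicit.
Unset Printing Implicit Defensive.

Import Order.TTheory GRing.Theory Num.Theory.
Import numFieldNormedType.Exports.

Local Open Scope classical_set_scope.
Local Open Scope ring_scope.
Local Open Scope complex_scope.
Local Open Scope quotient_scope.

(* The dimension is d.+1, so that it ranges over the integers >= 1. *)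

Section euclidean.
Context {R : realType} {d : nat}.
Implicit Types u v : 'cV[R]_d.+1.

Definition dotv u v : R := \sum_i u i 0 * v i 0.

Definition enorm u : R := Num.sqrt (dotv u u).

Definition wedge_norm u v : R :=
  Num.sqrt (enorm u ^+ 2 * enorm v ^+ 2 - dotv u v ^+ 2).

Definition opnorm (A : 'M[R]_d.+1) : R :=
  sup [set enorm (A *m v) | v in [set v | enorm v <= 1]].

Lemma dotvZ t s u v : dotv (t *: u) (s *: v) = t * s * dotv u v.
Proof.
rewrite /dotv mulr_sumr; apply: eq_bigr => i _.
by rewrite !mxE mulrACA.
Qed.

Lemma enormZ t u : enorm (t *: u) = `|t| * enorm u.
Proof. by rewrite /enorm dotvZ sqrtrM ?sqr_ge0 // -expr2 sqrtr_sqr. Qed.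

Lemma wedge_normZ t s u v :
  wedge_norm (t *: u) (s *: v) = `|t| * `|s| * wedge_norm u v.
Proof.
rewrite /wedge_norm !enormZ dotvZ.
rewrite -[`|t| * `|s|]ger0_norm ?mulr_ge0 // -[X in _ = X * _]sqrtr_sqr.
rewrite -sqrtrM ?sqr_ge0 //; congr Num.sqrt.
by rewrite !exprMn !real_normK ?num_real // mulrBr mulrACA.
Qed.

End euclidean.

(* GL_{d+1}(R), with the topology induced by the space of matrices and the
   corresponding Borel sigma-algebra. *)
Record GL (R : realType) (d : nat) := MkGL {
  gl_mx :> 'M[R]_d.+1 ;
  gl_unit : gl_mx \in unitmx }.

HB.instance Definition _ (R : realType) d := [isSub for @gl_mx R d].
HB.instance Definition _ (R : realType) d := [Choice of GL R d by <:].

Section GL.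
Context {R : realType} {d : nat}.
Implicit Types g h : GL R d.

Definition gl_one : GL R d := MkGL (unitmx1 R d.+1).

Fact gl_mul_subproof g h : (gl_mx g *m gl_mx h) \in unitmx.
Proof. by rewrite unitmx_mul !gl_unit. Qed.
Definition gl_mul g h : GL R d := MkGL (gl_mul_subproof g h).

Fact gl_inv_subproof g : invmx g \in unitmx.
Proof. by rewrite unitmx_inv gl_unit. Qed.
Definition gl_inv g : GL R d := MkGL (gl_inv_subproof g).

Definition gl_N g : R := Num.max (opnorm g) (opnorm (gl_inv g)).

End GL.

HB.instance Definition _ (R : realType) d := isPointed.Build (GL R d) gl_one.
HB.instance Definition _ (R : realType) d :=
  Topological.copy (GL R d) (initial_topology (@gl_mx R d)).
HB.instance Definition _ (R : realType) d :=
  Measurable.copy (GL R d) (g_sigma_algebraType (@open (GL R d))).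

Record nzvec (R : realType) (d : nat) := MkNzvec {
  nz_cV :> 'cV[R]_d.+1 ;
  nz_neq0 : nz_cV != 0 }.

HB.instance Definition _ (R : realType) d := [isSub for @nz_cV R d].
HB.instance Definition _ (R : realType) d := [Choice of nzvec R d by <:].
HB.instance Definition _ (R : realType) d :=
  Topological.copy (nzvec R d) (initial_topology (@nz_cV R d)).

Section nzvec.
Context {R : realType} {d : nat}.
Implicit Types u v w : nzvec R d.

Fact nzvec_one_subproof : const_mx 1 != 0 :> 'cV[R]_d.+1.
Proof.
apply/eqP => /matrixP/(_ 0 0); rewrite !mxE => /eqP.
by rewrite oner_eq0.
Qed.
Definition nzvec_one : nzvec R d := MkNzvec nzvec_one_subproof.

Definition collinear u v : bool :=
  `[< exists2 t : R, t != 0 & nz_cV u = t *: nz_cV v >].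

Lemma collinear_refl : reflexive collinear.
Proof. by move=> u; apply/asboolP; exists 1; rewrite ?oner_eq0 ?scale1r. Qed.

Lemma collinear_sym : symmetric collinear.
Proof.
suff H u v : collinear u v -> collinear v u by move=> u v; apply/idP/idP => /H.
move=> /asboolP[t t0 uv]; apply/asboolP; exists t^-1; first by rewrite invr_eq0.
by rewrite uv scalerA mulVf // scale1r.
Qed.

Lemma collinear_trans : transitive collinear.
Proof.
move=> v u w /asboolP[t t0 uv] /asboolP[s s0 vw]; apply/asboolP.
by exists (t * s); rewrite ?mulf_neq0 // uv vw scalerA.
Qed.

Canonical collinear_equiv :=
  EquivRel collinear collinear_refl collinear_sym collinear_trans.

End nzvec.

HB.instance Definition _ (R : realType) d :=
  isPointed.Build (nzvec R d) nzvec_one.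

(* The projective space: the quotient of the nonzero vectors by collinearity,
   with the quotient topology and the corresponding Borel sigma-algebra. *)
Definition projsp (R : realType) (d : nat) : Type :=
  quotient_topology {eq_quot (@collinear_equiv R d)}.

HB.instance Definition _ (R : realType) d :=
  PointedTopological.copy (projsp R d)
    (quotient_topology {eq_quot (@collinear_equiv R d)}).
HB.instance Definition _ (R : realType) d :=
  Quotient.copy (projsp R d)
    (quotient_topology {eq_quot (@collinear_equiv R d)}).
HB.instance Definition _ (R : realType) d :=
  Measurable.copy (projsp R d) (g_sigma_algebraType (@open (projsp R d))).

Section projsp.
Context {R : realType} {d : nat}.
Implicit Types (g : GL R d) (v : nzvec R d) (x y : projsp R d).

Definition dir v : projsp R d := \pi_(projsp R d)%qT v.

(* A chosen representative; the lemmas below show that the definitions using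
   it do not depend on the choice. *)
Definition rep x : nzvec R d := repr x.

Fact nz_mul_subproof g v : gl_mx g *m nz_cV v != 0.
Proof.
apply: contra (nz_neq0 v) => /eqP gv0.
by rewrite -[nz_cV v](mulKmx (gl_unit g)) gv0 mulmx0.
Qed.
Definition nz_mul g v : nzvec R d := MkNzvec (nz_mul_subproof g v).

Definition act g x : projsp R d := dir (nz_mul g (rep x)).

Definition pdist x y : R :=
  wedge_norm (rep x) (rep y) / (enorm (rep x) * enorm (rep y)).

Lemma repK x : dir (rep x) = x.
Proof. exact: reprK. Qed.

Lemma dir_eqP u v :
  dir u = dir v <-> exists2 t : R, t != 0 & nz_cV u = t *: nz_cV v.
Proof.
rewrite /dir; split => [uv|uv].
  have /eqquotP/asboolP// :
    u = v %[mod {eq_quot (@collinear_equiv R d)}] by exact: uv.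
suff : u = v %[mod {eq_quot (@collinear_equiv R d)}] by [].
by apply/eqquotP/asboolP.
Qed.

Lemma act_dir g v : act g (dir v) = dir (nz_mul g v).
Proof.
have /dir_eqP[t t0 tE] := repK (dir v).
by apply/dir_eqP; exists t; rewrite //= tE scalemxAr.
Qed.

Lemma pdist_dir u v :
  pdist (dir u) (dir v) = wedge_norm u v / (enorm u * enorm v).
Proof.
have /dir_eqP[t t0 tE] := repK (dir u).
have /dir_eqP[s s0 sE] := repK (dir v).
rewrite /pdist tE sE wedge_normZ !enormZ mulrACA invfM mulrACA divff ?mul1r //.
by rewrite mulf_neq0 // normr_eq0.
Qed.

End projsp.

Definition state (R : realType) (d : nat) : Type := (GL R d * projsp R d)%type.

HB.instance Definition _ (R : realType) d :=
  Topological.copy (state R d) (GL R d * projsp R d)%type.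
HB.instance Definition _ (R : realType) d :=
  Measurable.copy (state R d) (GL R d * projsp R d)%type.

Section cocycle.
Context {R : realType} {d : nat}.

Definition rho (x : state R d) : R :=
  ln (enorm (gl_mx x.1 *m rep x.2) / enorm (rep x.2)).

Lemma rho_dir (g : GL R d) (v : nzvec R d) :
  rho (g, dir v) = ln (enorm (gl_mx g *m v) / enorm v).
Proof.
have /dir_eqP[t t0 tE] := repK (dir v).
rewrite /rho /= tE -scalemxAr !enormZ invfM mulrACA divff ?mul1r //.
by rewrite normr_eq0.
Qed.

End cocycle.

Section banach_space.
Context {R : realType} {d : nat}.
Variables eps theta alpha beta : R.
Local Notation X := (state R d).
Implicit Types h : X -> R[i].

(* The norm of R[i] takes its values in R[i]; cmod is the same modulus in R. *)
Definition cmod (z : R[i]) : R := complex.Re `|z|.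

Definition sup_theta h : \bar R :=
  ereal_sup [set (cmod (h x) / gl_N x.1 `^ theta)%:E | x in [set: X]].

(* When d.+1 = 1 the projective space is a point: the maximum with 0 makes the
   supremum over the empty family equal to 0 (and not -oo). *)
Definition hol_dir h : \bar R :=
  Order.max 0%E (ereal_sup
    [set (cmod (h (t.1.1, t.1.2) - h (t.1.1, t.2)) /
          (pdist t.1.2 t.2 `^ eps * gl_N t.1.1 `^ alpha))%:E
    | t in [set t : GL R d * projsp R d * projsp R d | t.1.2 <> t.2]]).

Definition hol_mx h : \bar R :=
  ereal_sup
    [set (cmod (h (t.1.1, t.2) - h (t.1.2, t.2)) /
          (opnorm (gl_mx t.1.1 - gl_mx t.1.2) `^ eps *
           gl_N t.1.1 `^ beta * gl_N t.1.2 `^ beta))%:E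
    | t in [set t : GL R d * GL R d * projsp R d | t.1.1 <> t.1.2]].

Definition B_norm_of h : \bar R := (sup_theta h + hol_dir h + hol_mx h)%E.

Definition B_of : set (X -> R[i]) :=
  [set h | continuous (h : X -> R[i]^o) /\ (B_norm_of h < +oo)%E].

Definition dual_norm_of (L : (X -> R[i]) -> R[i]) : \bar R :=
  ereal_sup [set (cmod (L h))%:E | h in [set h | B_of h /\ (B_norm_of h <= 1)%E]].

End banach_space.

(* For delta0 > 8 the Hoelder exponent delta0 / 8 exceeds 1, and hol_mx h < +oo
   forces h to be constant along the paths of GL; hence the bound delta0 <= 8
   in the theorem. *)
Section banach_space_delta0.
Context {R : realType} {d : nat}.
Variable delta0 : R.
Let eps := delta0 / 8.

Definition B_norm (h : state R d -> R[i]) : \bar R :=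
  B_norm_of eps (3 * eps) (5 * eps) (7 * eps) h.

Definition B_space : set (state R d -> R[i]) :=
  B_of eps (3 * eps) (5 * eps) (7 * eps).

Definition B_dual_norm (L : (state R d -> R[i]) -> R[i]) : \bar R :=
  dual_norm_of eps (3 * eps) (5 * eps) (7 * eps) L.

Definition dirac_form (x : state R d) (h : state R d -> R[i]) : R[i] := h x.

(* A real function regarded as a complex one. *)
Definition cfun (f : state R d -> R) : state R d -> R[i] := fun x => (f x)%:C.

End banach_space_delta0.

Section random_walk.
Context {R : realType} {d : nat} {dO : measure_display}.
Context {Omega : measurableType dO}.

Definition independent_family (P : probability Omega R)
    (gs : nat -> {mfun Omega >-> GL R d}) : Prop :=
  forall (s : seq nat) (A : nat -> set (GL R d)), uniq s ->
    (forall i, measurable (A i)) ->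
    P (\bigcap_(i in [set` s]) (gs i @^-1` A i)) =
    (\prod_(i <- s) P (gs i @^-1` A i))%E.

Definition iid_with_law (P : probability Omega R)
    (mu : probability (GL R d) R) (gs : nat -> {mfun Omega >-> GL R d}) : Prop :=
  independent_family P gs /\
  forall n (A : set (GL R d)), measurable A -> P (gs n @^-1` A) = mu A.

(* The sequence (g_n)_{n >= 1} is indexed from 0: gs n stands for g_{n+1}. *)
Fixpoint walk (gs : nat -> {mfun Omega >-> GL R d}) (n : nat) (w : Omega) :
    GL R d :=
  if n is m.+1 then gl_mul (gs m w) (walk gs m w) else gl_one.

Definition chain (gs : nat -> {mfun Omega >-> GL R d}) (x : state R d)
    (n : nat) (w : Omega) : state R d :=
  if n is m.+1 then (gs m w, act (gl_mul (walk gs m w) x.1) x.2) else x.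

End random_walk.

Section invariant_measure.
Context {R : realType} {d : nat}.

Definition invariant_measure (mu : probability (GL R d) R)
    (nu : probability (projsp R d) R) : Prop :=
  forall phi : projsp R d -> R, continuous phi ->
    (\int[nu]_u \int[mu]_g (phi (act g u))%:E = \int[nu]_u (phi u)%:E)%E.

(* The functional nu-tilde on real functions, as an extended-real Lebesgue
   integral, so that no integrability is presupposed. *)
Definition nu_tilde (mu : probability (GL R d) R)
    (nu : probability (projsp R d) R) (h : state R d -> R) : \bar R :=
  (\int[mu \x nu]_x (h x)%:E)%E.

End invariant_measure.

(* Main.v *)
Require Import Defs.
From mathcomp Require Import all_boot all_order all_algebra.
From mathcomp Require Import all_classical all_reals all_analysis.
From mathcomp Require Import measurable_realfun.
From mathcomp Require Import ring lra.

(** The weight is the one of the sup norm: [Nt (g, u) = N(g)^theta] with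
    [theta = 3 eps], and [Ntl l] is a truncation [trunc l (Nt x)] which is
    continuous in [Nt x], vanishes for [Nt x <= l / 2] and equals [Nt x] for
    [Nt x >= l]. Both are functions of the size of the matrix alone, so the
    directional Hoelder seminorm vanishes on them.

    Everything concerning the Banach space rests on the inequality
    [|N(g) - N(h)| <= |g - h| N(g) N(h)] ([gl_N_dist]). As [eps <= 1], raising to
    the power [eps] preserves it, and factoring [a^3 - b^3] gives
    [|N(g)^theta - N(h)^theta| <= 3 |g - h|^eps (N(g) N(h))^(3 eps)]
    ([gl_N_pow_holder]), which is stronger than what membership requires since
    [3 eps <= 7 eps] and [N >= 1]. Composition with a function [F] that is
    [L]-Lipschitz and satisfies [|F t| <= t] multiplies this bound on the matrix
    seminorm by [L] ([B_norm_size_fun]); the truncations are all 2-Lipschitz, whence the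
    uniform bound on their norms. The same inequality makes the size continuous
    ([continuous_gl_N]), hence measurable.

    The three terms of the maximum are controlled as follows. A power of [N]
    dominates every power of [ln N >= |rho|] ([abs_rho_le],
    [sqr_ln_le_powR]). The norm of the Dirac mass is at most the weight of the sup
    norm, which is [Nt] ([dual_norm_dirac]). Finally the matrix component of
    [X_n] has law [mu] for [n >= 1], so with [pmax = 8/3] the moment
    [E_x (Nt (X_n)^pmax)] is the integral of [N^(8 eps) = N^delta0]
    ([integral_chain_mx]).

    The decay of [nu_tilde (Ntl l)] is Chebyshev's inequality with the same
    moment: [trunc l t <= (2 / l)^(5/3) t^(8/3)] ([trunc_le_powR]), so the
    exponent is [5/3 = 1 + 2/3]. *)

Set Implicit Arguments.
Unset Strict Implicit.
Unset Printing Implicit Defensive.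

Import Order.TTheory GRing.Theory Num.Theory.
Import numFieldNormedType.Exports.

Local Open Scope classical_set_scope.
Local Open Scope ring_scope.

(** * Euclidean and operator norms *)

Section euclidean_norm.
Context {R : realType} {d : nat}.
Implicit Types (u v : 'cV[R]_d.+1) (A B : 'M[R]_d.+1).

Lemma dotvv_ge0 u : 0 <= dotv u u.
Proof. by apply: sumr_ge0 => i _; rewrite -expr2 sqr_ge0. Qed.

Lemma enorm_ge0 u : 0 <= enorm u.
Proof. exact: sqrtr_ge0. Qed.

Lemma sqr_enorm u : enorm u ^+ 2 = dotv u u.
Proof. by rewrite sqr_sqrtr // dotvv_ge0. Qed.

Lemma enorm_gt0 u : u != 0 -> 0 < enorm u.
Proof.
apply: contraNT; rewrite -leNgt => u0.
have {}u0 : dotv u u = 0.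
  by rewrite -sqr_enorm (le_anti (introT andP (conj u0 (enorm_ge0 u)))) expr0n.
apply/eqP/matrixP => i j; rewrite (ord1 j) mxE.
have /eqP : u i 0 * u i 0 = 0.
  by apply: (psumr_eq0P _ u0) => // k _; rewrite -expr2 sqr_ge0.
by rewrite mulf_eq0 orbb => /eqP.
Qed.

(** Lagrange's identity: the defect in the inequality is half of the sum of the
    squares of the 2 x 2 minors of the matrix with columns [u] and [v]. *)
Lemma cauchy_schwarz u v : dotv u v ^+ 2 <= dotv u u * dotv v v.
Proof.
rewrite -subr_ge0 -(pmulr_rge0 _ (ltr0n R 2)).
have -> : 2 * (dotv u u * dotv v v - dotv u v ^+ 2) =
    \sum_i \sum_j (u i 0 * v j 0 - u j 0 * v i 0) ^+ 2.
  rewrite mulrBr [2 * (_ * _)]mulr_natl mulr2n {1}[dotv u u * _]mulrC.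
  rewrite expr2 /dotv !big_distrlr /= -big_split mulr_sumr -sumrB /=.
  apply: eq_bigr => i _; rewrite -big_split mulr_sumr -sumrB /=.
  by apply: eq_bigr => j _; ring.
by apply: sumr_ge0 => i _; apply: sumr_ge0 => j _; exact: sqr_ge0.
Qed.

Lemma dotv_le u v : dotv u v <= enorm u * enorm v.
Proof.
apply: le_trans (ler_norm _) _.
rewrite -(@ler_pXn2r _ 2) ?nnegrE ?mulr_ge0 ?enorm_ge0//.
by rewrite real_normK ?num_real// exprMn !sqr_enorm cauchy_schwarz.
Qed.

Lemma enormD u v : enorm (u + v) <= enorm u + enorm v.
Proof.
rewrite -(@ler_pXn2r _ 2) ?nnegrE ?addr_ge0 ?enorm_ge0//.
have -> : enorm (u + v) ^+ 2 = enorm u ^+ 2 + 2 * dotv u v + enorm v ^+ 2.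
  rewrite !sqr_enorm /dotv mulr_sumr -!big_split /=.
  by apply: eq_bigr => i _; rewrite !mxE; ring.
by rewrite sqrrD lerD2r lerD2l mulr_natl lerMn2r dotv_le.
Qed.

Lemma enormN u : enorm (- u) = enorm u.
Proof. by rewrite -scaleN1r enormZ normrN1 mul1r. Qed.

Definition frobenius A : R := Num.sqrt (\sum_i \sum_j A i j ^+ 2).

Lemma enorm_mulmx_frobenius A v : enorm (A *m v) <= frobenius A * enorm v.
Proof.
rewrite -(@ler_pXn2r _ 2) ?nnegrE ?mulr_ge0 ?enorm_ge0 ?sqrtr_ge0//.
rewrite exprMn [frobenius A ^+ 2]sqr_sqrtr; last first.
  by apply: sumr_ge0 => i _; apply: sumr_ge0 => j _; exact: sqr_ge0.
rewrite !sqr_enorm mulr_suml; apply: ler_sum => i _.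
have -> : (A *m v) i 0 = dotv (row i A)^T v.
  by rewrite mxE; apply: eq_bigr => j _; rewrite !mxE.
rewrite -expr2 (le_trans (cauchy_schwarz _ _))//.
by rewrite ler_wpM2r ?dotvv_ge0// ler_sum// => j _; rewrite !mxE expr2.
Qed.

Lemma opnorm_has_sup A :
  has_sup [set enorm (A *m v) | v in [set v | enorm v <= 1]].
Proof.
split; first by exists (enorm (A *m 0)), 0; rewrite //= -(scale0r 0) enormZ normr0 mul0r.
exists (frobenius A) => _ [v /= v1 <-].
apply: le_trans (enorm_mulmx_frobenius A v) _.
by rewrite ler_piMr// sqrtr_ge0.
Qed.

Lemma opnorm_ge0 A : 0 <= opnorm A.
Proof.
apply: le_trans (enorm_ge0 (A *m 0)) _.
apply: ub_le_sup; first by case: (opnorm_has_sup A).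
by exists 0; rewrite //= -(scale0r 0) enormZ normr0 mul0r.
Qed.

Lemma enorm_mulmx A v : enorm (A *m v) <= opnorm A * enorm v.
Proof.
have [->|v0] := eqVneq v 0.
  by rewrite mulmx0 -(scale0r 0) enormZ normr0 !(mul0r, mulr0).
have ev := enorm_gt0 v0.
rewrite -ler_pdivrMr// mulrC -[(enorm v)^-1]gtr0_norm ?invr_gt0//.
rewrite -enormZ scalemxAr; apply: ub_le_sup.
  by case: (opnorm_has_sup A).
by exists ((enorm v)^-1 *: v) => //=; rewrite enormZ gtr0_norm ?invr_gt0// mulVf// gt_eqF.
Qed.

Lemma opnorm_le A (k : R) :
  (forall v, enorm v <= 1 -> enorm (A *m v) <= k) -> opnorm A <= k.
Proof.
move=> Ak; apply: ge_sup; first by case: (opnorm_has_sup A).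
by move=> _ [v /= v1 <-]; exact: Ak.
Qed.

Lemma opnorm_frobenius A : opnorm A <= frobenius A.
Proof.
apply: opnorm_le => v v1; apply: le_trans (enorm_mulmx_frobenius A v) _.
by rewrite ler_piMr// sqrtr_ge0.
Qed.

Lemma opnormM A B : opnorm (A *m B) <= opnorm A * opnorm B.
Proof.
apply: opnorm_le => v v1; rewrite -mulmxA (le_trans (enorm_mulmx _ _))//.
rewrite ler_wpM2l ?opnorm_ge0// (le_trans (enorm_mulmx _ _))//.
by rewrite ler_piMr// opnorm_ge0.
Qed.

Lemma opnormD A B : opnorm (A + B) <= opnorm A + opnorm B.
Proof.
apply: opnorm_le => v v1; rewrite mulmxDl (le_trans (enormD _ _))//.
by rewrite lerD// (le_trans (enorm_mulmx _ _))// ler_piMr ?opnorm_ge0.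
Qed.

Lemma opnormN A : opnorm (- A) = opnorm A.
Proof.
rewrite /opnorm; congr sup; apply/seteqP.
by split=> _ [v v1 <-]; exists v; rewrite // mulNmx enormN.
Qed.

Lemma opnorm_distl A B : `|opnorm A - opnorm B| <= opnorm (A - B).
Proof.
have h (M K : 'M[R]_d.+1) : opnorm M <= opnorm K + opnorm (M - K).
  by have := opnormD K (M - K); rewrite [K + _]addrC subrK.
by rewrite ler_distl h lerBlDr andbT (le_trans (h B A))// -[A - B]opprB opnormN.
Qed.

End euclidean_norm.

(** * The size of an invertible matrix *)

Section gl_size.
Context {R : realType} {d : nat}.
Implicit Types g h : GL R d.

Lemma opnorm_le_N g : opnorm g <= gl_N g.
Proof. by rewrite le_max lexx. Qed.

Lemma opnormV_le_N g : opnorm (gl_inv g) <= gl_N g.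
Proof. by rewrite le_max lexx orbT. Qed.

Lemma gl_N_ge1 g : 1 <= gl_N g.
Proof.
have N0 : 0 <= gl_N g by rewrite (le_trans _ (opnorm_le_N g))// opnorm_ge0.
rewrite -(@ler_pXn2r _ 2) ?nnegrE// expr1n.
have v0 := enorm_gt0 (nz_neq0 (@nzvec_one R d)).
rewrite -(ler_pM2r v0) mul1r -{1}[nz_cV _](mulKmx (gl_unit g)).
rewrite (le_trans (enorm_mulmx _ _))// expr2 -mulrA.
apply: ler_pM; rewrite ?opnorm_ge0 ?enorm_ge0 ?opnormV_le_N//.
by rewrite (le_trans (enorm_mulmx _ _))// ler_wpM2r ?opnorm_le_N// ltW.
Qed.

Lemma gl_N_gt0 g : 0 < gl_N g.
Proof. exact: lt_le_trans (gl_N_ge1 g). Qed.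

Lemma gl_N_ge0 g : 0 <= gl_N g.
Proof. exact/ltW/gl_N_gt0. Qed.

(** [N(g), N(h) >= 1] absorbs the difference of the norms; for the inverses, use
    [g^-1 - h^-1 = g^-1 (h - g) h^-1]. *)
Lemma gl_N_dist g h :
  `|gl_N g - gl_N h| <= opnorm (gl_mx g - gl_mx h) * gl_N g * gl_N h.
Proof.
set D := _ * _ * _.
have D1 : `|opnorm g - opnorm h| <= D.
  rewrite (le_trans (opnorm_distl _ _))// /D -mulrA ler_peMr ?opnorm_ge0//.
  by rewrite mulr_ege1 ?gl_N_ge1.
have D2 : `|opnorm (gl_inv g) - opnorm (gl_inv h)| <= D.
  have -> : D = gl_N g * opnorm (gl_mx h - gl_mx g) * gl_N h.
    by rewrite /D [gl_N g * _]mulrC -opprB opnormN.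
  rewrite (le_trans (opnorm_distl _ _))//.
  have -> : gl_mx (gl_inv g) - gl_mx (gl_inv h) =
      gl_inv g *m (gl_mx h - gl_mx g) *m gl_inv h.
    by rewrite mulmxBr mulmxBl /= mulmxK ?gl_unit// mulVmx ?gl_unit// mul1mx.
  rewrite (le_trans (opnormM _ _))// ler_pM ?opnorm_ge0 ?opnormV_le_N//.
  by rewrite (le_trans (opnormM _ _))// ler_wpM2r ?opnorm_ge0 ?opnormV_le_N.
move: D1 D2; rewrite /gl_N !ler_distl => /andP[a1 a2] /andP[b1 b2].
apply/andP; split;
  case: (leP (opnorm g) (opnorm (gl_inv g))) => ?;
  case: (leP (opnorm h) (opnorm (gl_inv h))) => ?; lra.
Qed.

End gl_size.

(** * Hoelder bounds for powers of the size *)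

Section powers.
Context {R : realType}.
Implicit Types a b e : R.

(** Divide by [a + b]: if [s + t = 1] then [s <= s `^ e] and [t <= t `^ e]. *)
Lemma powR_subadditive a b e : 0 <= a -> 0 <= b -> 0 < e <= 1 ->
  (a + b) `^ e <= a `^ e + b `^ e.
Proof.
move=> a0 b0 /andP[e0 e1].
have [->|ab0] := eqVneq (a + b) 0.
  by rewrite powR0 ?gt_eqF// addr_ge0 ?powR_ge0.
have {}ab0 : 0 < a + b by rewrite lt_neqAle eq_sym ab0 addr_ge0.
have le_pow s : 0 <= s -> s <= 1 -> s <= s `^ e.
  rewrite le_eqVlt => /predU1P[<- _|s0 s1]; first by rewrite powR_ge0.
  by rewrite -[X in X <= _]powRr1 ?(ltW s0)// ger_powR// s0 s1.
have s1 : a / (a + b) <= 1 by rewrite ler_pdivrMr// mul1r lerDl.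
have t1 : b / (a + b) <= 1 by rewrite ler_pdivrMr// mul1r lerDr.
have s0 : 0 <= a / (a + b) by rewrite divr_ge0// ltW.
have t0 : 0 <= b / (a + b) by rewrite divr_ge0// ltW.
rewrite -[X in _ <= X `^ e + _](divfK (lt0r_neq0 ab0) a).
rewrite -[X in _ <= _ + X `^ e](divfK (lt0r_neq0 ab0) b).
rewrite (powRM _ s0 (ltW ab0)) (powRM _ t0 (ltW ab0)) -mulrDl ler_peMl ?powR_ge0//.
rewrite (le_trans _ (lerD (le_pow _ s0 s1) (le_pow _ t0 t1)))//.
by rewrite -mulrDl divff// gt_eqF.
Qed.

Lemma powR_holder a b e : 0 <= a -> 0 <= b -> 0 < e <= 1 ->
  `|a `^ e - b `^ e| <= `|a - b| `^ e.
Proof.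
wlog ab : a b / b <= a => [H a0 b0 e01|a0 b0 e01].
  have [ba|/ltW ab] := leP b a; first exact: H.
  by rewrite distrC [`|a - b|]distrC H.
have e0 : 0 <= e by case/andP: e01 => /ltW.
rewrite !ger0_norm ?subr_ge0 ?ge0_ler_powR ?nnegrE// lerBlDr.
by rewrite -{1}(subrK b a) powR_subadditive// subr_ge0.
Qed.

(** Apply [ln b <= b] to [b = a^(e / 2)]. *)
Lemma sqr_ln_le_powR a e : 1 <= a -> 0 < e ->
  ln a ^+ 2 <= (2 / e) ^+ 2 * a `^ e.
Proof.
move=> a1 e0; have a0 : 0 < a by exact: lt_le_trans a1.
have -> : a `^ e = (a `^ (e / 2)) ^+ 2.
  by rewrite -powR_mulrn ?powR_ge0// -powRrM divfK// pnatr_eq0.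
rewrite -exprMn lerXn2r ?nnegrE ?ln_ge0 ?mulr_ge0 ?invr_ge0 ?powR_ge0 ?(ltW e0)//.
rewrite -[2 / e]invf_div ler_pdivlMl ?divr_gt0// -ln_powR.
by apply/ltW/ln_sublinear; exact: powR_gt0.
Qed.

End powers.

Section size_power.
Context {R : realType} {d : nat}.
Implicit Types g h : GL R d.

(** With [a = N(g)^eps] and [b = N(h)^eps], factor
    [a^3 - b^3 = (a - b) (a^2 + a b + b^2)]. The first factor is at most
    [(|g - h| N(g) N(h))^eps], and the second one [3 (a b)^2] as [a, b >= 1]. *)
Lemma gl_N_pow_holder (eps : R) g h : 0 < eps <= 1 ->
  `|gl_N g `^ (3 * eps) - gl_N h `^ (3 * eps)| <=
  3 * (opnorm (gl_mx g - gl_mx h) `^ eps *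
       gl_N g `^ (7 * eps) * gl_N h `^ (7 * eps)).
Proof.
move=> e01; have e0 : 0 <= eps by case/andP: e01 => /ltW.
have powE (k : nat) (x : GL R d) : gl_N x `^ (k%:R * eps) = (gl_N x `^ eps) ^+ k.
  by rewrite mulrC powRrM powR_mulrn// powR_ge0.
rewrite !powE.
have ge1 (x : GL R d) : 1 <= gl_N x `^ eps.
  by rewrite -[leLHS](powRr0 (gl_N x)) ler_powR ?gl_N_ge1.
have dist_ab : `|gl_N g `^ eps - gl_N h `^ eps| <=
    opnorm (gl_mx g - gl_mx h) `^ eps * (gl_N g `^ eps * gl_N h `^ eps).
  rewrite (le_trans (powR_holder _ _ e01)) ?gl_N_ge0//.
  rewrite -!powRM ?mulr_ge0 ?opnorm_ge0 ?gl_N_ge0//.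
  rewrite ge0_ler_powR ?nnegrE ?mulr_ge0 ?opnorm_ge0 ?gl_N_ge0//.
  by rewrite mulrA gl_N_dist.
move: (ge1 g) (ge1 h) dist_ab (powR_ge0 (opnorm (gl_mx g - gl_mx h)) eps).
move: (gl_N g `^ eps) (gl_N h `^ eps) (opnorm _ `^ eps) => a b D a1 b1 abD D0.
have a0 : 0 <= a by exact: le_trans ler01 a1.
have b0 : 0 <= b by exact: le_trans ler01 b1.
have -> : a ^+ 3 - b ^+ 3 = (a - b) * (a ^+ 2 + a * b + b ^+ 2) by ring.
have q0 : 0 <= a ^+ 2 + a * b + b ^+ 2.
  by rewrite !addr_ge0 ?exprn_ge0 ?mulr_ge0.
rewrite normrM (ger0_norm q0).
have qab : a ^+ 2 + a * b + b ^+ 2 <= 3 * (a * b) ^+ 2.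
  have a2 : a ^+ 2 <= (a * b) ^+ 2 by rewrite exprMn ler_peMr ?exprn_ge0 ?exprn_ege1.
  have b2 : b ^+ 2 <= (a * b) ^+ 2 by rewrite exprMn ler_peMl ?exprn_ge0 ?exprn_ege1.
  have ab2 : a * b <= (a * b) ^+ 2 by rewrite expr2 ler_peMl ?mulr_ge0 ?mulr_ege1.
  lra.
rewrite (le_trans (ler_pM _ q0 abD qab))//.
have -> : D * (a * b) * (3 * (a * b) ^+ 2) = 3 * (D * (a * b) ^+ 3) by ring.
rewrite ler_wpM2l// -mulrA -exprMn ler_wpM2l//.
by rewrite ler_weXn2l// mulr_ege1.
Qed.

End size_power.

(** * Continuity of the size *)

Section size_continuity.
Context {R : realType} {d : nat}.

Lemma opnorm_le_entries (A : 'M[R]_d.+1) (e : R) :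
  (forall i j, `|A i j| <= e) -> opnorm A <= d.+1%:R * e.
Proof.
move=> Ae; apply: le_trans (opnorm_frobenius A) _.
have e0 : 0 <= e by exact: le_trans (Ae 0 0).
have -> : d.+1%:R * e = Num.sqrt (\sum_(i < d.+1) \sum_(j < d.+1) e ^+ 2).
  rewrite !sumr_const !card_ord -mulrnA -[e ^+ 2 *+ _]mulr_natl natrM -expr2 -exprMn.
  by rewrite sqrtr_sqr ger0_norm// mulr_ge0.
rewrite ler_wsqrtr// ler_sum// => i _; rewrite ler_sum// => j _.
by rewrite -real_normK ?num_real// ler_pXn2r ?nnegrE.
Qed.

(** The bound of [gl_N_dist] involves [N(h)] itself, which has to be controlled
    first: as soon as [|g - h| N(g) <= 1/2] it gives [N(h) <= 2 N(g)], and then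
    [|N(g) - N(h)| <= 2 |g - h| N(g)^2]. *)
Lemma continuous_gl_N : continuous (@gl_N R d).
Proof.
move=> g; apply/(@cvgrPdist_le _ _ _ (nbhs g)) => e e0.
set N := gl_N g; have N1 : 1 <= N := gl_N_ge1 g.
have N0 : 0 < N := gl_N_gt0 g.
pose r : R := Num.min (2 * N)^-1 (e / (2 * N ^+ 2)).
have r0 : 0 < r by rewrite lt_min invr_gt0 !divr_gt0 ?mulr_gt0 ?exprn_gt0.
have rN : r * N <= 2^-1.
  by rewrite -ler_pdivlMr// -invfM ge_min mulrC lexx.
have rN2 : r * (2 * N ^+ 2) <= e.
  by rewrite -ler_pdivlMr ?mulr_gt0 ?exprn_gt0// ge_min lexx orbT.
have : nbhs (gl_mx g) (ball (gl_mx g) (r / d.+1%:R)).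
  by apply: nbhsx_ballx; rewrite divr_gt0.
move=> /(@initial_continuous _ _ (@gl_mx R d) g).
apply: (@filterS _ (nbhs g)) => h /= ball_h.
have gh : opnorm (gl_mx g - gl_mx h) <= r.
  rewrite -[r](divfK (lt0r_neq0 (ltr0Sn R d))) mulrC.
  apply: opnorm_le_entries => i j; rewrite !mxE ltW//.
  exact: ball_h.2.
have := gl_N_dist g h; rewrite -/N.
have := opnorm_ge0 (gl_mx g - gl_mx h); have := gl_N_gt0 h.
move: (gl_N h) (opnorm _) gh => M D Dr M0 D0 le.
have DN : D * N <= r * N by rewrite ler_wpM2r// ltW.
have MN : M <= 2 * N.
  have : D * N * M <= 2^-1 * M by rewrite ler_wpM2r ?(le_trans DN)// ltW.
  move: le; rewrite ler_distl => /andP[+ _]; lra.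
apply: le_trans le (le_trans _ rN2).
rewrite (_ : r * _ = r * N * (2 * N)); last by ring.
by rewrite ler_pM// ?mulr_ge0// ltW.
Qed.

End size_continuity.

(** * Functions of the size in the Banach space *)

Section functions_of_size.
Context {R : realType} {d : nat}.
Implicit Types (eps L : R) (F : R -> R).

Lemma cmod_real (a : R) : cmod a%:C%C = `|a|.
Proof. by rewrite /cmod normc_def /= expr0n addr0 sqrtr_sqr. Qed.

Lemma continuous_cfun (f : state R d -> R) :
  continuous f -> continuous (cfun f : state R d -> R[i]^o).
Proof.
move=> cf x; apply/(@cvgrPdist_lt _ _ _ (nbhs x)) => e.
rewrite ltcE /= => /andP[/eqP ime ree].
have /(@cvgrPdist_lt _ _ _ (nbhs x))/(_ _ ree) := cf x.
apply: (@filterS _ (nbhs x)) => y fy.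
by rewrite /cfun -rmorphB /= normc_def /= expr0n addr0 sqrtr_sqr ltcE /= ime eqxx.
Qed.

Definition size_fun eps F (x : state R d) : R :=
  F (gl_N x.1 `^ (3 * eps)).

Lemma continuous_size_pow eps :
  continuous (fun g : GL R d => gl_N g `^ (3 * eps)).
Proof.
move=> g.
have -> : (fun g : GL R d => gl_N g `^ (3 * eps)) =
    (fun t => expR (3 * eps * ln t)) \o @gl_N R d.
  by apply/funext => h; rewrite /= /powR gt_eqF ?gl_N_gt0.
apply: continuous_comp; first exact: continuous_gl_N.
apply: (@continuous_comp _ _ _ (fun t => 3 * eps * ln t)); last exact: continuous_expR.
apply: cvgMr; exact/continuous_ln/gl_N_gt0.
Qed.

Lemma continuous_lipschitz L F :
  (forall s t, `|F s - F t| <= L * `|s - t|) -> continuous F.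
Proof.
move=> FL t; apply/cvgrPdist_le => e e0.
have L1 : 0 < `|L| + 1 by rewrite ltr_wpDl.
near=> s; rewrite (le_trans (FL _ _))//.
rewrite (@le_trans _ _ ((`|L| + 1) * `|t - s|))//.
  by rewrite ler_wpM2r// (le_trans (ler_norm L))// lerDl.
rewrite mulrC -ler_pdivlMr//.
near: s; apply: cvgr_dist_le => //; by rewrite divr_gt0.
Unshelve. all: by end_near. Qed.

Lemma continuous_size_fun eps L F :
  (forall s t, `|F s - F t| <= L * `|s - t|) ->
  continuous (fun g : GL R d => F (gl_N g `^ (3 * eps))).
Proof.
move=> FL g; apply: (@continuous_comp _ _ _ (fun g : GL R d => gl_N g `^ (3 * eps))).
  exact: continuous_size_pow.
exact: continuous_lipschitz FL _.
Qed.

(** Valid for [b = 0] as well, because then [a / b = 0]. *)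
Lemma ler_wpdivrMr (a b c : R) : 0 <= b -> 0 <= c -> a <= c * b -> a / b <= c.
Proof.
rewrite le_eqVlt => /predU1P[<- c0 _|b0 _]; first by rewrite invr0 mulr0.
by rewrite ler_pdivrMr.
Qed.

(** The 1 bounds the weighted sup norm and the [3 * L] the matrix seminorm; the
    directional seminorm is 0. *)
Lemma B_norm_size_fun eps L F : 0 < eps <= 1 ->
  (forall s t, `|F s - F t| <= L * `|s - t|) ->
  (forall t, 0 <= t -> `|F t| <= t) ->
  (B_norm_of eps (3 * eps) (5 * eps) (7 * eps) (cfun (size_fun eps F))
   <= (1 + 3 * L)%:E)%E.
Proof.
move=> eps01 FL Ft.
have L0 : 0 <= L.
  by have := le_trans (normr_ge0 _) (FL 1 0); rewrite subr0 normr1 mulr1.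
rewrite -[1 + _]addr0 [1 + _ + 0]addrAC !EFinD /B_norm_of; apply: leeD; first apply: leeD.
- apply: ge_ereal_sup => _ [x _ <-]; rewrite lee_fin cmod_real.
  by rewrite ler_wpdivrMr ?powR_ge0// mul1r Ft ?powR_ge0.
- rewrite ge_max lexx /=; apply: ge_ereal_sup => _ [t _ <-].
  by rewrite lee_fin /cfun /size_fun /= -rmorphB subrr /= cmod_real normr0 mul0r.
- apply: ge_ereal_sup => _ [[[g h] u] _ <-] /=; rewrite lee_fin.
  rewrite /cfun /size_fun /= -rmorphB /= cmod_real.
  rewrite ler_wpdivrMr ?mulr_ge0 ?powR_ge0// (le_trans (FL _ _))//.
  by rewrite [3 * L]mulrC -[L * 3 * _]mulrA ler_wpM2l// gl_N_pow_holder.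
Qed.

Lemma B_of_size_fun eps L F : 0 < eps <= 1 ->
  (forall s t, `|F s - F t| <= L * `|s - t|) ->
  (forall t, 0 <= t -> `|F t| <= t) ->
  B_of eps (3 * eps) (5 * eps) (7 * eps) (cfun (size_fun eps F)).
Proof.
move=> eps01 FL Ft; split.
  2: by rewrite (le_lt_trans (B_norm_size_fun eps01 FL Ft))// ltry.
apply: continuous_cfun => x.
apply: (@continuous_comp _ _ _ fst (fun g : GL R d => F (gl_N g `^ (3 * eps)))).
  exact: cvg_fst.
exact: continuous_size_fun FL _.
Qed.

(** If the norm of [h] is at most 1, so is its weighted sup norm, because the
    other two terms of the norm are nonnegative. For the last one this uses two
    distinct matrices, [1] and [2]: the supremum over an empty family would be
    [-oo]. *)
Lemma dual_norm_dirac (eps theta alpha beta : R) (x : state R d) :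
  (dual_norm_of eps theta alpha beta (dirac_form x) <=
   (gl_N x.1 `^ theta)%:E)%E.
Proof.
apply: ge_ereal_sup => _ [h [_ hB] <-]; rewrite lee_fin.
have hol_dir0 : (0 <= hol_dir eps alpha h)%E by rewrite le_max lexx.
have two_unit : 2%:M \in @unitmx R d.+1.
  by rewrite unitmxE det_scalar unitfE expf_neq0// pnatr_eq0.
pose g2 : GL R d := MkGL two_unit.
have g2_neq : g2 <> gl_one.
  move/(congr1 (fun g : GL R d => gl_mx g 0 0)); rewrite /= !mxE /= => /eqP.
  by rewrite (eqr_nat R 2 1).
have hol_mx0 : (0 <= hol_mx eps beta h)%E.
  pose t := (g2, @gl_one R d, x.2).
  apply: le_trans (ereal_sup_ubound _); last by exists t.
  by rewrite lee_fin divr_ge0 ?mulr_ge0 ?powR_ge0// /cmod normc_def sqrtr_ge0.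
have : ((cmod (h x) / gl_N x.1 `^ theta)%:E <= 1)%E.
  apply: le_trans hB; apply: (@le_trans _ _ (sup_theta theta h)).
    by apply: ereal_sup_ubound; exists x.
  by rewrite /B_norm_of -addeA leeDl// adde_ge0.
by rewrite lee_fin ler_pdivrMr ?powR_gt0 ?gl_N_gt0// mul1r.
Qed.

End functions_of_size.

(** * The norm cocycle *)

Section cocycle_bound.
Context {R : realType} {d : nat}.

(** [|g v| <= N(g) |v|], and [|v| <= N(g) |g v|] as [v = g^-1 (g v)]. *)
Lemma abs_rho_le (x : state R d) : `|rho x| <= ln (gl_N x.1).
Proof.
case: x => g u; rewrite /rho /=; set v := nz_cV (rep u).
have v0 : 0 < enorm v := enorm_gt0 (nz_neq0 _).
have gv0 : 0 < enorm (gl_mx g *m v) := enorm_gt0 (nz_neq0 (nz_mul g (rep u))).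
have N0 := gl_N_gt0 g.
have q0 : 0 < enorm (gl_mx g *m v) / enorm v by rewrite divr_gt0.
rewrite ler_norml -lnV ?posrE// !ler_ln ?posrE ?invr_gt0//; apply/andP; split.
  rewrite ler_pdivlMr// ler_pdivrMl//.
  rewrite -{1}[v](mulKmx (gl_unit g)) (le_trans (enorm_mulmx _ _))//.
  by rewrite ler_wpM2r ?enorm_ge0// opnormV_le_N.
rewrite ler_pdivrMr// (le_trans (enorm_mulmx _ _))//.
by rewrite ler_wpM2r ?enorm_ge0// opnorm_le_N.
Qed.

End cocycle_bound.

(** * Truncation *)

Section truncation.
Context {R : realType}.
Implicit Types l s t : R.

(** The line [2 t - l] joins the value 0 at [l / 2] to the value [l] at [l], so
    this is 0 up to [l / 2], then of slope 2 up to [l], then the identity. *)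
Definition trunc l t : R := Num.max 0 (Num.min t (2 * t - l)).

Lemma trunc_ge0 l t : 0 <= trunc l t.
Proof. by rewrite le_max lexx. Qed.

Lemma trunc_lipschitz l s t : `|trunc l s - trunc l t| <= 2 * `|s - t|.
Proof.
wlog st : s t / s <= t => [H|].
  have [/H//|/ltW ts] := leP s t.
  by rewrite distrC [`|s - t|]distrC H.
have mono : trunc l s <= trunc l t.
  rewrite /trunc ge_max le_max lexx /= le_max le_min !ge_min.
  by apply/orP; right; apply/andP; split; apply/orP; [left|right]; lra.
have slope : trunc l t <= trunc l s + 2 * (t - s).
  rewrite [leLHS]/trunc ge_max; apply/andP; split.
    by rewrite addr_ge0 ?trunc_ge0//; lra.
  rewrite -lerBlDr le_max le_min !lerBlDr !ge_min.
  by apply/orP; right; apply/andP; split; apply/orP; [left|right]; lra.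
rewrite distrC [`|s - t|]distrC !ger0_norm ?subr_ge0//.
by rewrite lerBlDl.
Qed.

Lemma trunc_le l t : 0 <= t -> trunc l t <= t.
Proof. by move=> t0; rewrite ge_max t0 ge_min lexx. Qed.

Lemma trunc_id l t : 0 <= l -> l <= t -> t <= trunc l t.
Proof. by move=> l0 lt; rewrite le_max le_min; apply/orP; right; lra. Qed.

(** [1 <= (2 t / l)^p] wherever [trunc l t != 0]. *)
Lemma trunc_le_powR l t (p : R) : 0 < l -> 0 <= t -> 0 <= p ->
  trunc l t <= (2 / l) `^ p * t `^ (1 + p).
Proof.
move=> l0 t0 p0; have [tl|lt] := leP (2 * t) l.
  have -> : trunc l t = 0.
    by apply/max_idPl; rewrite ge_min; apply/orP; right; lra.
  by rewrite mulr_ge0 ?powR_ge0.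
have {}t0 : 0 < t by lra.
rewrite (le_trans (trunc_le _ (ltW t0)))//.
rewrite powRD; last by rewrite (gt_eqF t0) implybT.
rewrite powRr1 ?(ltW t0)// mulrCA ler_peMr ?(ltW t0)//.
rewrite -powRM ?(ltW t0)// ?divr_ge0 ?(ltW l0)//.
rewrite -[leLHS](powRr0 (2 / l * t)) ler_powR//.
by rewrite mulrAC ler_pdivlMr// mul1r ltW.
Qed.

End truncation.

(** * Moments *)

Section moments.
Context {R : realType} {d : nat}.

Lemma measurable_continuous_GL (f : GL R d -> R) :
  continuous f -> measurable_fun setT f.
Proof.
move=> /continuousP cf.
apply: (measurability _ (RGenOpens.measurableE R)).
move=> _ [_ [a [b ->] <-]]; rewrite setTI; apply: sub_sigma_algebra.
exact/cf/interval_open.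
Qed.

Lemma measurable_size_pow (e : R) :
  measurable_fun setT (fun g : GL R d => gl_N g `^ e).
Proof.
apply: (measurableT_comp (measurable_powR e)).
by apply: measurable_continuous_GL; exact: continuous_gl_N.
Qed.

(** At time [n + 1] the matrix component of the chain is the new increment, of
    law [mu], whatever the starting point. *)
Lemma integral_chain_mx {dO : measure_display} {Omega : measurableType dO}
    (P : probability Omega R) (mu : probability (GL R d) R)
    (gs : nat -> {mfun Omega >-> GL R d}) (f : GL R d -> \bar R)
    (x : state R d) (n : nat) :
  iid_with_law P mu gs -> measurable_fun setT f -> (forall g, 0 <= f g)%E ->
  (\int[P]_w f (chain gs x n.+1 w).1 = \int[mu]_g f g)%E.
Proof.
move=> [_ law] mf f0.
have := @ge0_integral_pushforward _ _ _ _ R (gs n) (measurable_funPT (gs n))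
  P setT f measurableT mf (fun y _ => f0 y).
rewrite preimage_setT => <-.
by apply: eq_measure_integral => A mA _; exact: law.
Qed.

Lemma nu_tilde_mx (mu : probability (GL R d) R) (nu : probability (projsp R d) R)
    (f : GL R d -> R) :
  measurable_fun setT f -> (forall g, 0 <= f g) ->
  nu_tilde mu nu (fun x => f x.1) = (\int[mu]_g (f g)%:E)%E.
Proof.
move=> mf f0; rewrite /nu_tilde.
rewrite (@fubini_tonelli1 _ _ _ _ R mu nu (fun x => (f x.1)%:E)); first last.
- by move=> x; rewrite lee_fin.
- apply/measurable_EFinP; exact: (measurableT_comp mf).
apply: eq_integral => g _; rewrite /fubini_F /=.
rewrite integral_cst; last exact: measurableT.
have nu1 : nu setT = 1%E by exact: probability_setT.
by rewrite [X in (_ * X)%E]nu1 mule1.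
Qed.

End moments.

(** * The weight and its truncations *)

Theorem proposition0p8 (R : realType) (d : nat)
  (mu : probability (GL R d) R) (nu : probability (projsp R d) R)
  (dO : measure_display) (Omega : measurableType dO) (P : probability Omega R)
  (gs : nat -> {mfun Omega >-> GL R d}) (delta0 : R)
  (hgs : iid_with_law P mu gs)
  (hnu : invariant_measure mu nu)
  (hdelta0 : 0 < delta0) (hdelta0_le : delta0 <= 8)
  (P1 : (\int[mu]_g (gl_N g `^ delta0)%:E < +oo)%E) :
  exists (Nt : state R d -> R) (Ntl : nat -> state R d -> R),
    [/\ B_space delta0 (cfun Nt) /\ (forall x, 0 <= Nt x),
        forall l, (1 <= l)%N ->
          B_space delta0 (cfun (Ntl l)) /\ (forall x, 0 <= Ntl l x),
        (exists pmax gamma c : R,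
          [/\ 2 < pmax, 0 < gamma, 0 < c &
            forall (x : state R d) (n : nat), (1 <= n)%N ->
              (Order.max (`|rho x| `^ (1 + gamma))%:E
                 (Order.max (B_dual_norm delta0 (dirac_form x))
                    ('E_P[(fun w => Nt (chain gs x n w) `^ pmax)%R] `^ pmax^-1))
               <= (c * (1 + Nt x))%:E)%E]) /\
        (forall (x : state R d) (l : nat), (1 <= l)%N ->
           Nt x * \1_[set y | l%:R < Nt y] x <= Ntl l x),
        exists c : R, 0 < c /\
          forall l, (1 <= l)%N -> (B_norm delta0 (cfun (Ntl l)) <= c%:E)%E
      & exists delta c : R, [/\ 0 < delta, 0 < c &
          forall l, (1 <= l)%N ->
            (`|nu_tilde mu nu (Ntl l)| <= (c / l%:R `^ (1 + delta))%:E)%E]].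
Proof.
pose eps := delta0 / 8.
have eps01 : 0 < eps <= 1 by apply/andP; split; rewrite /eps; lra.
have eps0 : 0 < eps by case/andP: eps01.
pose K := fine (\int[mu]_g (gl_N g `^ delta0)%:E).
have KE : (\int[mu]_g (gl_N g `^ delta0)%:E = K%:E)%E.
  rewrite /K fineK// ge0_fin_numE// integral_ge0// => g _.
  by rewrite lee_fin powR_ge0.
have K0 : 0 <= K.
  by rewrite -lee_fin -KE integral_ge0// => g _; rewrite lee_fin powR_ge0.
have idL (s t : R) : `|id s - id t| <= 1 * `|s - t| by rewrite mul1r.
have id_le (t : R) : 0 <= t -> `|id t| <= t by move=> t0; rewrite ger0_norm.
have trL (l : nat) := @trunc_lipschitz R l%:R.
have tr_le (l : nat) (t : R) : 0 <= t -> `|trunc l%:R t| <= t.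
  by move=> t0; rewrite ger0_norm ?trunc_ge0// trunc_le.
pose Nt : state R d -> R := size_fun eps id.
pose Ntl (l : nat) : state R d -> R := size_fun eps (trunc l%:R).
have powE (g : GL R d) : (gl_N g `^ (3 * eps)) `^ (8 / 3) = gl_N g `^ delta0.
  by rewrite -powRrM; congr (_ `^ _); rewrite /eps; field.
exists Nt, Ntl; split.
- split; last by move=> x; exact: powR_ge0.
  exact: (B_of_size_fun eps01 idL id_le).
- move=> l _; split; last by move=> x; exact: trunc_ge0.
  exact: (B_of_size_fun eps01 (trL l) (tr_le l)).
- split.
    pose c0 : R := (2 / (3 * eps)) ^+ 2; pose c1 : R := K `^ (8 / 3)^-1.
    (* One constant for each of the three terms of the maximum: c0, 1 and c1. *)
    have c00 : 0 <= c0 by exact: sqr_ge0.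
    have c10 : 0 <= c1 by exact: powR_ge0.
    exists (8 / 3), 1, (c0 + 1 + c1); split; [lra|lra|lra|].
    move=> x [//|n] _.
    have N0 : 0 <= Nt x by exact: powR_ge0.
    have Nc (c : R) : 0 <= c -> 0 <= c * Nt x by move=> ?; exact: mulr_ge0.
    have := Nc _ c00; have := Nc _ c10 => c1N c0N.
    rewrite !ge_max; apply/and3P; split.
    + rewrite lee_fin -[1 + 1]/(2%:R) powR_mulrn//.
      apply: (@le_trans _ _ (c0 * Nt x)); last by lra.
      rewrite (le_trans _ (sqr_ln_le_powR (gl_N_ge1 x.1) _)) ?mulr_gt0//.
      by rewrite lerXn2r ?nnegrE ?ln_ge0 ?gl_N_ge1// abs_rho_le.
    + apply: (le_trans (dual_norm_dirac _ _ _ _ _)).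
      rewrite -/eps lee_fin -[X in X <= _]/(Nt x); lra.
    + rewrite unlock.
      under eq_integral do rewrite /Nt /size_fun powE.
      rewrite (integral_chain_mx (f := fun g => (gl_N g `^ delta0)%:E) x n hgs); first last.
      * by move=> g; rewrite lee_fin powR_ge0.
      * by apply/measurable_EFinP; exact: measurable_size_pow.
      rewrite KE poweR_EFin lee_fin -/c1; lra.
  move=> x l l1; rewrite indicE; case: (boolP (_ \in _)).
    rewrite inE /= mulr1 => lN; apply: trunc_id => //; exact: ltW.
  by rewrite mulr0 trunc_ge0.
- exists (1 + 3 * 2); split; first by lra.
  move=> l _; exact: (B_norm_size_fun eps01 (trL l) (tr_le l)).
- exists (2 / 3), (2 `^ (5 / 3) * (K + 1)); split; [lra| |].
    by rewrite mulr_gt0 ?powR_gt0//; lra.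
  move=> l l1; have l0 : 0 < l%:R :> R by rewrite ltr0n.
  have mF : measurable_fun setT (fun g : GL R d => trunc l%:R (gl_N g `^ (3 * eps))).
    by apply: measurable_continuous_GL; exact: continuous_size_fun (trL l).
  rewrite (nu_tilde_mx mu nu mF); last by move=> g; exact: trunc_ge0.
  rewrite gee0_abs; last by apply: integral_ge0 => g _; rewrite lee_fin trunc_ge0.
  apply: (@le_trans _ _ (\int[mu]_g (((2 / l%:R) `^ (5 / 3))%:E * (gl_N g `^ delta0)%:E)))%E.
    apply: ge0_le_integral => //.
    + by move=> g _; rewrite lee_fin trunc_ge0.
    + exact/measurable_EFinP.
    + apply/measurable_EFinP/measurable_funM => //; exact: measurable_size_pow.
    + move=> g _; rewrite -EFinM lee_fin -powE.
      rewrite (_ : 8 / 3 = 1 + 5 / 3); last by field.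
      by rewrite trunc_le_powR ?powR_ge0//; lra.
  rewrite ge0_integralZl//; first last.
  + by move=> g _; rewrite lee_fin powR_ge0.
  + by apply/measurable_EFinP; exact: measurable_size_pow.
  rewrite KE -EFinM lee_fin powRM ?invr_ge0//.
  rewrite (_ : 1 + 2 / 3 = 5 / 3); last by field.
  have -> : l%:R^-1 `^ (5 / 3) = (l%:R `^ (5 / 3))^-1 :> R.
    by rewrite -powR_inv1 ?ler0n// -powRrM mulN1r powRN.
  rewrite mulrAC ler_pM2r ?invr_gt0 ?powR_gt0//.
  by rewrite ler_pM2l ?powR_gt0//; lra.
Qed.
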